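(* Let $\mathcal{T}=(\mathcal{V},\mathcal{E})$ be a finite tree with geodesic distance $\mathcal{S}$, and let $m\ge 1$ be an integer. Let $\mathcal{T}^{\star}$ be the $(1,m)$-star-fractal tree of $\mathcal{T}$. Then the geodesic distance $\mathcal{S}^{\star}$ of $\mathcal{T}^{\star}$ is $$\mathcal{S}^{\star}=2(m+2)^{2}\mathcal{S}-(m+2)(|\mathcal{V}|-1)(m+|\mathcal{V}|).$$
   Context: For a connected finite graph $G$, its geodesic distance is $\mathcal{S}(G)=\sum_{\{u,v\}} d_G(u,v)$, the sum of the shortest-path distances over all unordered pairs of distinct vertices of $G$. The $(1,m)$-star-fractal graph of a graph $G=(\mathcal{V},\mathcal{E})$ is obtained by replacing every edge $uv\in\mathcal{E}$ by a path $uwv$ of length $2$ with a new vertex $w$ (distinct for each edge), and additionally attaching $m$ new pendant vertices to each such new vertex $w$ (all new vertices distinct). *)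

(* Defs.v *)
From HB Require Import structures.
From mathcomp Require Import all_boot all_order all_algebra.

Set Implicit Arguments.
Unset Strict Implicit.
Unset Printing Implicit Defensive.

Record sgraph := SGraph {
  vertex :> finType;
  adj : rel vertex;
  adj_sym : symmetric adj;
  adj_irrefl : irreflexive adj
}.

Arguments adj {s}.

Definition connected_graph (G : sgraph) : Prop :=
  forall x y : G, connect adj x y.

Definition acyclic (G : sgraph) : Prop :=
  forall c : seq G, 2 < size c -> ~ ucycle adj c.

Definition is_tree (G : sgraph) : Prop :=
  [/\ 0 < #|G|, connected_graph G & acyclic G].

Definition walk_of_length (G : sgraph) (x y : G) (n : nat) : bool :=
  [exists p : n.-tuple G, path adj x p && (last x p == y)].

(* The least length of a walk from x to y. Between connected vertices it is
   less than #|G|; it takes the junk value #|G| when there is no walk. *)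
Definition gdist (G : sgraph) (x y : G) : nat :=
  find (walk_of_length x y) (iota 0 #|G|).

(* Each unordered pair of distinct vertices is listed once, in the order given
   by the enumeration of G. *)
Definition geodesic_distance (G : sgraph) : nat :=
  \sum_(p : G * G | enum_rank p.1 < enum_rank p.2) gdist p.1 p.2.

Lemma gdist_le (G : sgraph) (x : G) (p : seq G) :
  path adj x p -> gdist x (last x p) <= size p.
Proof.
move=> xp; rewrite /gdist.
have w : walk_of_length x (last x p) (size p).
  by apply/existsP; exists (in_tuple p); rewrite /= xp eqxx.
have [lt|ge] := ltnP (size p) #|G|; last first.
  by apply: leq_trans ge; rewrite -[leqRHS](size_iota 0) find_size.
rewrite leqNgt; apply/negP => /(before_find 0).
by rewrite nth_iota // add0n w.
Qed.

Lemma gdist_geodesic (G : sgraph) (x y : G) : connect adj x y ->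
  exists p : seq G, [/\ path adj x p, last x p = y & size p = gdist x y].
Proof.
case/connectP=> p0 p0P ->; have [p xp up _] := shortenP p0P.
have lt : size p < #|G|.
  by have := max_card (mem (x :: p)); rewrite (card_uniqP up).
have lt' : gdist x (last x p) < #|G| := leq_ltn_trans (gdist_le xp) lt.
have : has (walk_of_length x (last x p)) (iota 0 #|G|).
  by rewrite has_find size_iota.
move/(nth_find 0); rewrite -/(gdist _ _) nth_iota // add0n.
case/existsP=> q /andP[xq /eqP lq].
by exists q; split; rewrite ?size_tuple.
Qed.

Definition edges (G : sgraph) : {set {set G}} :=
  [set [set p.1; p.2] | p : G * G & adj p.1 p.2].

Section StarFractal.
Variables (G : sgraph) (m : nat).

Definition edge : finType := {A : {set G} | A \in edges G}.

Inductive sf_sort :=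
  | Old of G
  | Mid of edge
  | Pendant of edge & 'I_m.

Definition sf_code (x : sf_sort) : G + (edge + edge * 'I_m) :=
  match x with
  | Old u => inl u
  | Mid w => inr (inl w)
  | Pendant w i => inr (inr (w, i))
  end.

Definition sf_decode (x : G + (edge + edge * 'I_m)) : sf_sort :=
  match x with
  | inl u => Old u
  | inr (inl w) => Mid w
  | inr (inr (w, i)) => Pendant w i
  end.

Lemma sf_codeK : cancel sf_code sf_decode. Proof. by case. Qed.

HB.instance Definition _ := Countable.copy sf_sort (can_type sf_codeK).
HB.instance Definition _ : isFinite sf_sort := CanIsFinite sf_codeK.

Definition sf_adj (x y : sf_sort) : bool :=
  match x, y with
  | Old u, Mid w | Mid w, Old u => u \in val w
  | Mid w, Pendant w' _ | Pendant w' _, Mid w => w == w'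
  | _, _ => false
  end.

Lemma sf_adj_sym : symmetric sf_adj. Proof. by move=> [?|?|? ?] [?|?|? ?]. Qed.

Lemma sf_adj_irrefl : irreflexive sf_adj. Proof. by case. Qed.

Definition star_fractal : sgraph := SGraph sf_adj_sym sf_adj_irrefl.

End StarFractal.

(* Main.v *)
(** Write [E = |V| - 1], [W] for the sum of [d(u,v)] over ordered pairs of
    vertices of the tree [T], and [g_v(ab) = d(a,v) + d(b,v)].  Rooting [T] at
    [v], every vertex other than [v] is the lower end [c] of exactly one edge,
    whose upper end is at distance [d(c,v) - 1]; so [g_v] sums to
    [2 * sum_c d(c,v) - E] over the edges.  In the star-fractal tree the
    distances are [2 d(u,v)] between old vertices, [g_v(e)] from [v] to the
    midpoint of [e], and [(g_a(e) + g_b(e)) / 2] between the midpoints of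
    distinct edges [e] and [ab]; a pendant vertex is one further away than its
    midpoint.  Summing over all ordered pairs expresses everything through [W]
    and [E]. *)

Require Import Defs.
From mathcomp Require Import all_boot all_order all_algebra.
From mathcomp Require Import zify.

Set Implicit Arguments.
Unset Strict Implicit.
Unset Printing Implicit Defensive.

(** * Geodesic distance in connected graphs *)

Section ConnectedGraph.
Variable G : sgraph.
Hypothesis connG : connected_graph G.

Lemma gdistxx (x : G) : gdist x x = 0.
Proof. by apply/eqP; rewrite -leqn0 (@gdist_le G x [::]). Qed.

Lemma gdist_eq0 (x y : G) : (gdist x y == 0) = (x == y).
Proof.
apply/eqP/eqP=> [d0|->]; last exact: gdistxx.
have [p [_ lp sp]] := gdist_geodesic (connG x y).
by move: sp lp; rewrite d0 => /size0nil ->.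
Qed.

Lemma gdist_symW (x y : G) : gdist y x <= gdist x y.
Proof.
have [p [xp lp <-]] := gdist_geodesic (connG x y).
have yp : path adj y (rev (belast x p)).
  rewrite -lp rev_path; apply: sub_path xp => a b /=.
  by rewrite adj_sym.
have := gdist_le yp; rewrite size_rev size_belast.
suff -> : last y (rev (belast x p)) = x by [].
by case: p {xp yp} lp => [|z p] //= lp; rewrite rev_cons last_rcons.
Qed.

Lemma gdist_sym (x y : G) : gdist x y = gdist y x.
Proof. by apply/eqP; rewrite eqn_leq !gdist_symW. Qed.

Lemma gdist_adj (x y z : G) : adj x y -> gdist x z <= (gdist y z).+1.
Proof.
move=> xy; have [p [yp lp <-]] := gdist_geodesic (connG y z).
by have := @gdist_le G x (y :: p); rewrite /= xy yp lp; apply.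
Qed.

Lemma gdist_step (x z : G) :
  x != z -> exists2 y, adj x y & gdist x z = (gdist y z).+1.
Proof.
move=> xz; have [[|y p] [/= xp lp sp]] := gdist_geodesic (connG x z).
  by rewrite lp eqxx in xz.
case/andP: xp => xy yp; exists y => //; apply/eqP.
by rewrite eqn_leq gdist_adj // -sp ltnS -lp gdist_le.
Qed.

Lemma gdist_leaf (x y z : G) :
  (forall t, adj x t -> t = y) -> x != z -> gdist x z = (gdist y z).+1.
Proof. by move=> leaf /gdist_step[t /leaf->]. Qed.

(** The diagonal contributes 0, and swapping the coordinates matches the pairs of decreasing rank
    with those of increasing rank. *)
Lemma sum_gdist :
  \sum_(x : G) \sum_(y : G) gdist x y = (geodesic_distance G).*2.
Proof.
rewrite pair_bigA /= (bigID (fun p => enum_rank p.1 < enum_rank p.2)) /=.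
rewrite -addnn; congr (_ + _).
rewrite (bigID (fun p => p.1 == p.2)) /= big1 ?add0n; last first.
  by case=> x y /andP[_ /eqP /= ->]; rewrite gdistxx.
have swapK : involutive (fun p : G * G => (p.2, p.1)) by case.
rewrite (reindex_inj (inv_inj swapK)) /=.
apply: eq_big => [[x y]|[x y] _] /=; last exact: gdist_sym.
rewrite -leqNgt andbC [in RHS]ltn_neqAle; congr (_ && _).
by rewrite (inj_eq val_inj) (inj_eq enum_rank_inj) eq_sym.
Qed.

End ConnectedGraph.

(** * Distances certified by a potential function *)

Section Potential.
Variables (G : sgraph) (z : G) (f : G -> nat).
Hypothesis f_step : forall x, x != z -> exists2 y, adj x y & f x = (f y).+1.

Lemma potential_walk (x : G) :
  exists p, [/\ path adj x p, last x p = z & size p <= f x].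
Proof.
move: {2}(f x) (leqnn (f x)) => n; elim: n x => [|n IHn] x lefn;
  (have [->|xz] := eqVneq x z; first by exists [::]);
  have [y xy fx] := f_step xz; first by rewrite fx in lefn.
have [|p [yp lp sp]] := IHn y; first by rewrite -ltnS -fx.
by exists (y :: p); rewrite /= xy yp fx ltnS.
Qed.

Lemma potential_connect (x : G) : connect adj x z.
Proof. by have [p [xp lp _]] := potential_walk x; apply/connectP; exists p. Qed.

(** Descending along [f] gives a walk of length at most [f x]. Conversely, [f] drops by at most 1
    per edge, so a geodesic to [z], where [f] vanishes, has at least [f x] edges. *)
Lemma gdist_potential (x : G) :
    f z = 0 -> (forall a b, adj a b -> f a <= (f b).+1) ->
  gdist x z = f x.
Proof.
move=> fz lipf; apply/eqP; rewrite eqn_leq; apply/andP; split.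
  have [p [xp lp]] := potential_walk x.
  by apply: leq_trans; rewrite -lp gdist_le.
have [p [xp lp <-]] := gdist_geodesic (potential_connect x).
elim: p x xp lp => [|y p IHp] x /=; first by move=> _ ->; rewrite fz.
case/andP=> xy yp lp; apply: leq_trans (lipf _ _ xy) _.
by rewrite ltnS IHp.
Qed.

End Potential.

(** * Trees *)

Section Tree.
Variable T : sgraph.
Hypothesis connT : connected_graph T.
Hypothesis acyclicT : acyclic T.

Lemma adj_neq (a b : T) : adj a b -> a != b.
Proof. by apply: contraTneq => ->; rewrite adj_irrefl. Qed.

Definition adj_avoiding (x a b : T) := [&& adj a b, a != x & b != x].

Lemma adj_avoiding_sym (x : T) : symmetric (adj_avoiding x).
Proof. by move=> a b; rewrite /adj_avoiding adj_sym [(a != x) && _]andbC. Qed.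

(** The later vertices of a geodesic from [a] to [v] are strictly closer to [v] than [a], hence than
    [x], so the geodesic misses [x]. *)
Lemma connect_avoiding (x a v : T) :
  a != x -> gdist a v <= gdist x v -> connect (adj_avoiding x) a v.
Proof.
move: {2}(gdist a v) (leqnn (gdist a v)) => n.
elim: n a => [|n IHn] a lean ax leax;
  (have [->|av] := eqVneq a v; first exact: connect0);
  have [b ab da] := gdist_step connT av; first by rewrite da in lean.
have bx : b != x by apply/eqP=> bx; rewrite da bx ltnn in leax.
apply: connect_trans (IHn b _ bx _); [|lia|lia].
by apply: connect1; rewrite /adj_avoiding ab ax bx.
Qed.

(** Otherwise a simple path from [a] to [b] avoiding [x] would close up through [x] into a cycle
    with at least three vertices. *)
Lemma acyclic_avoiding (x a b : T) :
  adj x a -> adj x b -> connect (adj_avoiding x) a b -> a = b.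
Proof.
move=> xa xb /connectP[p0 ap0]; have [p ap up _] := shortenP ap0.
case: p ap up => [//|c p] ap up lb.
case: (@acyclicT [:: x, a, c & p]) => //; apply/andP; split.
  rewrite -[cycle _ _]/(path adj x (rcons [:: a, c & p] x)) rcons_path.
  apply/andP; split; last by rewrite -[last _ _]/(last a (c :: p)) -lb adj_sym.
  by rewrite /= xa; apply: sub_path ap => ? ? /and3P[].
rewrite cons_uniq up andbT.
have nx: all (predC1 x) (c :: p).
  elim: (c :: p) (a) ap {up lb xa} => //= d q IHq e /andP[/and3P[_ _ ->]].
  by move/IHq.
rewrite inE negb_or; apply/andP; split; last first.
  by apply/negP=> /(allP nx); rewrite /= eqxx.
exact: adj_neq.
Qed.

(** Both neighbours are joined to [v], hence to each other, without passing through [x]. *)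
Lemma parent_unique (x a b v : T) : adj x a -> adj x b ->
  gdist a v <= gdist x v -> gdist b v <= gdist x v -> a = b.
Proof.
move=> xa xb da db; apply: (acyclic_avoiding xa xb).
have neq c : adj x c -> c != x by rewrite adj_sym => /adj_neq.
apply: connect_trans (connect_avoiding (neq _ xa) da) _.
rewrite (sym_connect_sym (@adj_avoiding_sym x)).
exact: connect_avoiding (neq _ xb) db.
Qed.

(** In case of equality, [b] and the next vertex on a geodesic from [a] to [v] would both be
    neighbours of [a] no farther from [v], hence equal, although the latter is strictly closer. *)
Lemma gdist_adj_neq (a b v : T) : adj a b -> gdist a v != gdist b v.
Proof.
move=> ab; apply/eqP=> dab; have [av|av] := eqVneq a v.
  move/eqP: dab; rewrite av gdistxx eq_sym gdist_eq0 // => /eqP bv.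
  by rewrite av bv adj_irrefl in ab.
have [p ap da] := gdist_step connT av.
have bp : b = p by apply: (@parent_unique a b p v) => //; lia.
by rewrite -bp in da; lia.
Qed.

Lemma adj_gdist (a b v : T) : adj a b ->
  gdist a v = (gdist b v).+1 \/ gdist b v = (gdist a v).+1.
Proof.
move=> ab; have ba : adj b a by rewrite adj_sym.
have := gdist_adj_neq v ab; have := gdist_adj connT v ab.
by have := gdist_adj connT v ba; lia.
Qed.

(** * Edges of the rooted tree and their lower ends *)

Definition child_of (v : T) (e : edge T) (c : T) : bool :=
  [exists p, [&& adj c p, val e == [set c; p] & gdist c v == (gdist p v).+1]].

Lemma edgeP (e : edge T) : exists a b, adj a b /\ val e = [set a; b].
Proof.
by case: e => A /= /imsetP[[a b]]; rewrite inE /= => ab ->; exists a, b.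
Qed.

Lemma child_exists (v : T) (e : edge T) : exists c, child_of v e c.
Proof.
have [a [b [ab eab]]] := edgeP e; have ba : adj b a by rewrite adj_sym.
have [dab|dba] := adj_gdist v ab.
  by exists a; apply/existsP; exists b; rewrite ab eab dab !eqxx.
by exists b; apply/existsP; exists a; rewrite ba eab dba setUC !eqxx.
Qed.

Definition child (v : T) (e : edge T) : T := xchoose (child_exists v e).

Lemma childP (v : T) (e : edge T) : exists p,
  [/\ adj (child v e) p, val e = [set child v e; p]
    & gdist (child v e) v = (gdist p v).+1].
Proof.
have /existsP[p /and3P[? /eqP ? /eqP ?]] := xchooseP (child_exists v e).
by exists p.
Qed.

Lemma child_inj (v : T) : injective (child v).
Proof.
move=> e e' eqc; apply: val_inj.
have [p [cp -> dp]] := childP v e; have [p' [cp' -> dp']] := childP v e'.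
rewrite -{}eqc in cp' dp' *; congr [set _; _].
by apply: (parent_unique (v := v) cp cp'); lia.
Qed.

Lemma child_image (v : T) : child v @: setT = [set~ v].
Proof.
apply/setP=> u; rewrite !inE; apply/imsetP/idP=> [[e _ ->]|uv].
  have [p [_ _ dp]] := childP v e.
  by apply/eqP=> cv; rewrite {1}cv gdistxx in dp.
have [p up dp] := gdist_step connT uv.
have eP : [set u; p] \in edges T by apply/imsetP; exists (u, p); rewrite ?inE.
exists (Sub [set u; p] eP : edge T) => //.
have [q [cq /= eq_e dq]] := childP v (Sub [set u; p] eP : edge T).
move: (child v _) cq eq_e dq => c cq eq_e dq.
have : c \in [set u; p] by rewrite eq_e !inE eqxx.
rewrite !inE => /orP[/eqP-> //|/eqP cp].
(* If the lower end were [p], its parent [q] would be [u], contradicting [dp], or [p] itself, giving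
   a loop. *)
have : q \in [set u; p] by rewrite eq_e !inE eqxx orbT.
rewrite !inE => /orP[/eqP qu|/eqP qp]; subst; first by lia.
by have := adj_irrefl p; rewrite cq.
Qed.

Lemma sum_child (v : T) (F : T -> nat) :
  \sum_(e : edge T) F (child v e) = \sum_(u | u != v) F u.
Proof.
transitivity (\sum_(u in child v @: setT) F u).
  rewrite big_imset /=; last by move=> ? ? _ _; apply: child_inj.
  by apply: eq_bigl => e; rewrite inE.
by apply: eq_bigl => u; rewrite child_image !inE.
Qed.

Lemma card_edge (v : T) : #|T| = #|edge T|.+1.
Proof.
rewrite -!sum1_card (bigD1 v) //= add1n; congr _.+1.
by rewrite -(sum_child v (fun=> 1)).
Qed.

(** This will be the distance from [v] to the midpoint of [e] in the star-fractal tree. *)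
Definition edist (v : T) (e : edge T) : nat := \sum_(u in val e) gdist u v.

Lemma sum_edge (e : edge T) (a b : T) (F : T -> nat) :
  adj a b -> val e = [set a; b] -> \sum_(u in val e) F u = F a + F b.
Proof. by move=> ab ->; rewrite big_setU1 ?inE ?adj_neq // big_set1. Qed.

Lemma edist_child (v : T) (e : edge T) :
  (edist v e).+1 = (gdist (child v e) v).*2.
Proof.
have [p [cp eE dp]] := childP v e.
by rewrite /edist (sum_edge _ cp eE) dp; lia.
Qed.

Lemma sum_edist (v : T) :
  \sum_(e : edge T) edist v e + #|edge T| = (\sum_(u : T) gdist u v).*2.
Proof.
rewrite -sum1_card -big_split /=.
rewrite (eq_bigr (fun e => (gdist (child v e) v).*2)); last first.
  by move=> e _; rewrite addn1 edist_child.
rewrite (sum_child v (fun u => (gdist u v).*2)) [in RHS](bigD1 v) //= gdistxx.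
by rewrite add0n -mul2n big_distrr /=; apply: eq_bigr => u _; rewrite mul2n.
Qed.

(* Otherwise the next vertex on the geodesic from [b] to [x] is not [a], yet it
   is, like [a], a neighbour of [b] no farther from [y] than [b]. *)
Lemma crossing_edges (a b x y : T) : adj a b -> adj x y ->
  gdist a x = (gdist b x).+1 -> gdist b y = (gdist a y).+1 -> b = x.
Proof.
move=> ab xy dx dy; apply/eqP; apply: contraT => bx.
have [c bc dc] := gdist_step connT bx.
have ba : adj b a by rewrite adj_sym.
have yx : adj y x by rewrite adj_sym.
have := gdist_adj connT c yx; rewrite !(gdist_sym connT _ c) => cy.
have := gdist_adj connT a xy; rewrite !(gdist_sym connT _ a) => ax.
have ca : c = a by apply: (parent_unique (v := y) bc ba); lia.
by rewrite ca in dc; lia.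
Qed.

(** Both ends of [f] lie on the same side of [e]. The end [c] facing away from [f] is one farther
    from each of them than [p], hence the 2. *)
Lemma edist_neq (e f : edge T) : e != f -> exists c p,
  [/\ adj c p, val e = [set c; p] & edist c f = (edist p f).+2].
Proof.
have [a [b [ab eE]]] := edgeP e; have [x [y [xy fE]]] := edgeP f.
move=> ef; have ba : adj b a by rewrite adj_sym.
have yx : adj y x by rewrite adj_sym.
have eqe u v : adj u v -> (u = x /\ v = y) \/ (u = y /\ v = x) ->
    val e != [set u; v].
  move=> uv uvxy; apply: contraNneq ef => euv; apply/eqP/val_inj.
  by rewrite euv fE; case: uvxy => -[-> ->] //; rewrite setUC.
have ed v : edist v f = gdist v x + gdist v y.
  by rewrite /edist (sum_edge _ xy fE) !(gdist_sym connT v).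
have [dx|dx] := adj_gdist x ab; have [dy|dy] := adj_gdist y ab.
- by exists a, b; rewrite !ed dx dy; split=> //; lia.
(* If the ends of [f] were on opposite sides of [e], crossing in both directions would identify the
   two edges. *)
- have bx := crossing_edges ab xy dx dy.
  have ay := crossing_edges ba yx dy dx.
  by case/eqP: (eqe _ _ ab (or_intror (conj ay bx))).
- have ax := crossing_edges ba xy dx dy.
  have bY := crossing_edges ab yx dy dx.
  by case/eqP: (eqe _ _ ab (or_introl (conj ax bY))).
- by exists b, a; rewrite !ed dx dy setUC; split=> //; lia.
Qed.

(** * Distances in the star-fractal tree *)

Section StarFractalTree.
Variable m : nat.
Local Notation TS := (star_fractal T m).
Local Notation old u := (Old m u : TS).
Local Notation mid e := (Mid m e : TS).
Local Notation pendant e i := (Pendant e i : TS).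

Definition old_potential (v : T) (x : TS) : nat :=
  match x with
  | Old u => (gdist u v).*2
  | Mid e => edist v e
  | Pendant e _ => (edist v e).+1
  end.

(** The ends of [e] lie at distances [d] and [d - 1] from [v], so [edist v e = 2d - 1] is within 1
    of twice either of them. *)
Lemma edist_mem (v u : T) (e : edge T) : u \in val e ->
  (gdist u v).*2 <= (edist v e).+1 /\ edist v e <= (gdist u v).*2.+1.
Proof.
have [p [cp eE dp]] := childP v e.
by have := edist_child v e; rewrite {1}eE !inE => ? /orP[]/eqP->; lia.
Qed.

(** An old vertex descends to the midpoint of its parent edge, a midpoint to the upper end of its
    edge, a pendant vertex to its midpoint. *)
Lemma old_potential_step (v : T) (x : TS) : x != old v ->
  exists2 y, adj x y & old_potential v x = (old_potential v y).+1.
Proof.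
case: x => [u|e|e i] xv /=.
- have uv : u != v by apply: contraNneq xv => ->.
  have : u \in child v @: setT by rewrite child_image !inE.
  case/imsetP=> e _ ->; exists (mid e) => /=; last by rewrite edist_child.
  by have [p [_ -> _]] := childP v e; rewrite !inE eqxx.
- have [p [cp eE dp]] := childP v e.
  exists (old p); first by rewrite /= eE !inE eqxx orbT.
  by rewrite /=; have := edist_child v e; lia.
- by exists (mid e) => /=; rewrite ?eqxx.
Qed.

Lemma old_potential_adj (v : T) (x y : TS) :
  adj x y -> old_potential v x <= (old_potential v y).+1.
Proof.
case: x y => [u|e|e i] [u'|e'|e' i'] //= xy.
- by have := edist_mem v xy; lia.
- by have := edist_mem v xy; lia.
- by rewrite (eqP xy); lia.
- by rewrite (eqP xy).
Qed.

Lemma gdist_to_old (v : T) (x : TS) : gdist x (old v) = old_potential v x.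
Proof.
apply: gdist_potential; [exact: old_potential_step|by rewrite /= gdistxx|].
exact: old_potential_adj.
Qed.

Lemma star_fractal_connected : 0 < #|T| -> connected_graph TS.
Proof.
case/card_gt0P=> v _ x y; apply: (@connect_trans _ _ (old v)).
  exact: potential_connect (@old_potential_step v) x.
rewrite (sym_connect_sym (@adj_sym TS)).
exact: potential_connect (@old_potential_step v) y.
Qed.

Hypothesis connTS : connected_graph TS.

Lemma gdist_pendant (e : edge T) (i : 'I_m) (y : TS) :
  y != pendant e i -> gdist (pendant e i) y = (gdist (mid e) y).+1.
Proof.
rewrite eq_sym; apply: gdist_leaf => // -[u|f|f j] //= /eqP.
by move->.
Qed.

(** For distinct edges a geodesic leaves [e] through its end [p] facing [f], so its length is
    [edist p f + 1], the mean of [edist p f] and [edist p f + 2]. For [e = f] each end contributes 1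
    to the right side, hence the diagonal correction 2. *)
Lemma gdist_mid_mid (e f : edge T) :
  (gdist (mid e) (mid f)).*2 + (e == f).*2 = \sum_(u in val e) edist u f.
Proof.
have [<-|ef] := eqVneq e f.
  have [a [b [ab eE]]] := edgeP e; rewrite gdistxx /edist.
  rewrite !(sum_edge _ ab eE) !gdistxx (gdist_sym connT b).
  suff -> : gdist a b = 1 by [].
  have := gdist_adj connT b ab; rewrite gdistxx.
  by have := gdist_eq0 connT a b; rewrite (negPf (adj_neq ab)); lia.
have [c [p [cp eE ecp]]] := edist_neq ef.
have dold u : gdist (old u) (mid f) = edist u f.
  by rewrite gdist_sym // gdist_to_old.
have mid_mem u : u \in val e -> gdist (mid e) (mid f) <= (edist u f).+1.
  by move=> ue; rewrite -dold; apply: gdist_adj.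
have mp : gdist (mid e) (mid f) <= (edist p f).+1.
  by apply: mid_mem; rewrite eE !inE eqxx orbT.
rewrite (sum_edge _ cp eE) ecp addn0.
have : mid e != mid f by apply: contraNneq ef => -[->].
case/(gdist_step connTS) => -[u|g|g i] //= me.
  by rewrite dold; move: me; rewrite eE !inE => /orP[]/eqP->; lia.
(* A first step to a pendant vertex would have to return to [mid e], so it cannot shorten the
   distance. *)
by rewrite -/(pendant g i) gdist_pendant // (eqP me); lia.
Qed.

(** * Summing distances over the star-fractal tree *)

Local Notation n := #|T|.
Local Notation E := #|edge T|.

Lemma sum_star_fractal (F : TS -> nat) : \sum_(x : TS) F x =
  \sum_(u : T) F (old u) + \sum_(e : edge T) F (mid e)
    + \sum_(e : edge T) \sum_(i < m) F (pendant e i).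
Proof.
have sf_decodeK : cancel (@sf_decode T m) (@sf_code T m) by case=> [|[|[]]].
rewrite (reindex (@sf_decode T m)) /=; last first.
  by exists (@sf_code T m) => x _; rewrite ?sf_codeK ?sf_decodeK.
rewrite big_sumType big_sumType /= addnA pair_bigA; congr (_ + _).
by apply: eq_bigr => -[].
Qed.

Lemma card_star_fractal : #|TS| = n + E + m * E.
Proof.
rewrite -sum1_card sum_star_fractal !sum1_card; congr (_ + _).
rewrite (eq_bigr (fun=> m)) => [|e _]; last exact: card_ord.
by rewrite sum_nat_const mulnC.
Qed.

Local Notation W := (\sum_(u : T) \sum_(v : T) gdist u v).
Local Notation OM := (\sum_(v : T) \sum_(e : edge T) edist v e).
Local Notation MM :=
  (\sum_(e : edge T) \sum_(f : edge T) gdist (mid e) (mid f)).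

Lemma sum_old_mid : OM + n * E = W.*2.
Proof.
rewrite -sum_nat_const -big_split /= exchange_big -mul2n big_distrr /=.
by apply: eq_bigr => v _; rewrite sum_edist mul2n.
Qed.

(** Summing [gdist_mid_mid] over all [e] and [f] gives [2 MM + 2 E]. By [sum_edist] at both ends of
    each [e], the same sum is [2 OM - 2 E * E]. *)
Lemma sum_mid_mid : MM + E + E * E = OM.
Proof.
apply: double_inj; rewrite !doubleD.
have -> : MM.*2 + E.*2 =
    \sum_(e : edge T) \sum_(u in val e) \sum_(f : edge T) edist u f.
  rewrite -!mul2n -[E]sum1_card !big_distrr -big_split /=.
  apply: eq_bigr => e _; rewrite exchange_big /=.
  rewrite -(eq_bigr _ (fun f _ => gdist_mid_mid e f)) big_split /=.
  rewrite big_distrr /=; congr (_ + _).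
    by apply: eq_bigr => f _; rewrite mul2n.
  rewrite (bigD1 e) //= eqxx big1 // => f fe.
  by rewrite eq_sym (negPf fe).
rewrite -mul2n -sum_nat_const big_distrr -big_split /=.
rewrite -mul2n [X in _ = 2 * X]exchange_big big_distrr /=.
apply: eq_bigr => e _; have [a [b [ab eE]]] := edgeP e.
rewrite (sum_edge _ ab eE).
have := sum_edist a; have := sum_edist b.
have -> : \sum_(v : T) edist v e = \sum_u gdist u a + \sum_u gdist u b.
  rewrite -big_split /=; apply: eq_bigr => v _.
  by rewrite /edist (sum_edge _ ab eE) !(gdist_sym connT v).
by move=> db da; rewrite mulnDr !mul2n -da -db -addnn addnACA.
Qed.

Lemma sum_old_row :
  \sum_(u : T) \sum_(y : TS) gdist (old u) y = W.*2 + OM + m * (OM + n * E).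
Proof.
have dmid u e : gdist (old u) (mid e) = edist u e.
  by rewrite gdist_sym // gdist_to_old.
rewrite (eq_bigr (fun u => 2 * \sum_v gdist u v + \sum_e edist u e
    + m * (\sum_e edist u e + E))); last first.
  move=> u _; rewrite sum_star_fractal; congr (_ + _ + _).
  - by rewrite big_distrr; apply: eq_bigr => v _; rewrite gdist_to_old /= mul2n.
  - by apply: eq_bigr => e _.
  - rewrite -sum1_card -big_split big_distrr; apply: eq_bigr => e _ /=.
    rewrite (eq_bigr (fun=> edist u e + 1)) ?sum_nat_const ?card_ord // => i _.
    by rewrite gdist_sym // gdist_pendant // gdist_sym // dmid addn1.
rewrite 2!big_split /= -!big_distrr /= mul2n; congr (_ + _ * _).
by rewrite big_split /= sum_nat_const.
Qed.

Lemma sum_mid_row : \sum_(e : edge T) \sum_(y : TS) gdist (mid e) y =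
  OM + MM + m * (MM + E * E).
Proof.
rewrite [OM]exchange_big -big_split /= -sum_nat_const -big_split big_distrr /=.
rewrite -big_split; apply: eq_bigr => e _; rewrite sum_star_fractal /=.
congr (_ + _ + _); first by apply: eq_bigr => v _; rewrite gdist_to_old.
rewrite -sum1_card -big_split big_distrr; apply: eq_bigr => f _ /=.
rewrite (eq_bigr (fun=> gdist (mid e) (mid f) + 1)).
  by rewrite sum_nat_const card_ord.
by move=> i _; rewrite gdist_sym // gdist_pendant // gdist_sym // addn1.
Qed.

(** The pendant row exceeds the midpoint row by 1 at every [y] except the pendant vertex itself,
    where the entries are 0 and 1; the 2 offsets that exception. *)
Lemma sum_pendant_row (e : edge T) (i : 'I_m) :
  \sum_(y : TS) gdist (pendant e i) y + 2 =
    \sum_(y : TS) gdist (mid e) y + #|TS|.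
Proof.
rewrite -sum1_card -big_split (bigD1 (pendant e i)) //= gdistxx add0n.
rewrite [RHS](bigD1 (pendant e i)) //= gdist_sym // gdist_pendant // gdistxx.
rewrite addnC; congr (_ + _).
by apply: eq_bigr => y /gdist_pendant ->; rewrite addn1.
Qed.

(** Each midpoint row counts [m.+1] times, once for itself and once for each of its [m] pendant
    vertices. The term [2 * m * E] collects the corrections of the [m * E] pendant rows. *)
Lemma sum_gdist_star_fractal :
  \sum_(x : TS) \sum_(y : TS) gdist x y + 2 * m * E =
    W.*2 + OM + m * (OM + n * E)
      + m.+1 * (OM + MM + m * (MM + E * E)) + m * E * (n + E + m * E).
Proof.
rewrite -sum_old_row -sum_mid_row -card_star_fractal sum_star_fractal.
rewrite [in RHS]mulSn addnA -[LHS]addnA -[RHS]addnA; congr (_ + _).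
rewrite (_ : 2 * m * E = \sum_(e : edge T) \sum_(i < m) 2); last first.
  by rewrite !sum_nat_const card_ord [m * 2]mulnC mulnC.
rewrite -big_split /= big_distrr /=.
rewrite (_ : m * E * #|TS| = \sum_(e : edge T) m * #|TS|); last first.
  by rewrite sum_nat_const mulnCA mulnA.
rewrite -big_split; apply: eq_bigr => e _ /=.
rewrite -big_split (eq_bigr _ (fun i _ => sum_pendant_row e i)).
by rewrite sum_nat_const card_ord mulnDr.
Qed.

End StarFractalTree.
End Tree.

Local Open Scope ring_scope.

Theorem theorem3 (T : sgraph) (hT : is_tree T) (m : nat) (hm : (1 <= m)%N) :
  (geodesic_distance (star_fractal T m))%:Z =
    2 * (m%:Z + 2) ^+ 2 * (geodesic_distance T)%:Z
    - (m%:Z + 2) * (#|T|%:Z - 1) * (m%:Z + #|T|%:Z).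
Proof.
case: hT => T0 connT acyclicT; have /card_gt0P[v _] := T0.
have connTS := star_fractal_connected connT acyclicT (m := m) T0.
have total := sum_gdist_star_fractal connT acyclicT connTS.
have := sum_old_mid connT acyclicT.
have := sum_mid_mid connT acyclicT connTS.
have := card_edge connT acyclicT v; move: total.
rewrite !sum_gdist //.
move: (\sum_v _)%N (\sum_e _)%N #|T| #|edge T| => OM MM n E.
move: (geodesic_distance _) (geodesic_distance _) => S' S total cardE midE oldE.
(* Substituting [OM = 4 S - n E], [MM = OM - E - E * E] and [n = E + 1] turns [total] into twice the
   claimed polynomial identity. *)
nia.
Qed.
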